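(* Let $I$ be a non-degenerate interval and $f:I\to\mathbb{R}$ continuous. Let $D(f)$ be the set of points where $f$ has a derivative (finite or infinite) and $\mathsf{M}_1(f)$ the set of $\mathsf{M}_1$-points of $f$. Then there is a set $E\subseteq I$ with $\mathcal{H}^1(\{(x,f(x)):x\in E\})=0$ and $D(f)\subseteq\mathsf{M}_1(f)\subseteq D(f)\cup E$. In particular, $f$ is differentiable at almost every $\mathsf{M}_1$-point (in the sense of $\mathcal{H}^1$ on the graph).
   Context: $\mathcal{H}^1$ is one-dimensional Hausdorff measure in $\mathbb{R}^2$. With $\psi(x)=(x,f(x))$ and the Euclidean norm, $y\in I$ is an $\mathsf{M}_1$-point of $f$ if there is $\varepsilon>0$ such that $|\psi(x)-\psi(y)|\le|\psi(x)-\psi(z)|$ for all $x\in I\cap(y-\varepsilon,y)$ and $z\in I\cap(y,y+\varepsilon)$. *)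

(* Defs.v *)
From HB Require Import structures.
From mathcomp Require Import all_boot all_order all_algebra.
From mathcomp Require Import all_classical all_reals all_analysis.
Set Implicit Arguments. Unset Strict Implicit. Unset Printing Implicit Defensive.
Import Order.TTheory GRing.Theory Num.Theory.
Import numFieldNormedType.Exports.
Local Open Scope classical_set_scope.
Local Open Scope ring_scope.

Section Defs.
Variable R : realType.

Definition dist2 (p q : R * R) : R :=
  Num.sqrt ((p.1 - q.1) ^+ 2 + (p.2 - q.2) ^+ 2).

(* diameter of a subset of R^2 (value 0 for the empty set), in \bar R *)
Definition diam2 (C : set (R * R)) : \bar R :=
  ereal_sup ([set 0%E] `|` [set (dist2 p q)%:E | p in C & q in C]).

Definition hausdorff1_delta (delta : R) (A : set (R * R)) : \bar R :=
  ereal_inf [set (\sum_(0 <= i <oo) diam2 (C i))%E | C in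
     [set C : nat -> set (R * R) |
        A `<=` \bigcup_i C i /\ forall i, (diam2 (C i) <= delta%:E)%E]].

Definition hausdorff1 (A : set (R * R)) : \bar R :=
  ereal_sup [set hausdorff1_delta delta A | delta in [set d : R | 0 < d]].

Definition psi (f : R -> R) (x : R) : R * R := (x, f x).

Definition graph_on (f : R -> R) (E : set R) : set (R * R) := psi f @` E.

Definition diffq (f : R -> R) (y x : R) : R := (f x - f y) / (x - y).

Definition has_deriv_ext (f : R -> R) (I : set R) (y : R) : Prop :=
  I y /\
  ((exists l : R, forall e, 0 < e -> exists2 d, 0 < d &
       forall x, I x -> x != y -> `|x - y| < d -> `|diffq f y x - l| < e)
   \/ (forall M : R, exists2 d, 0 < d &
       forall x, I x -> x != y -> `|x - y| < d -> M < diffq f y x)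
   \/ (forall M : R, exists2 d, 0 < d &
       forall x, I x -> x != y -> `|x - y| < d -> diffq f y x < M)).

Definition D_set (f : R -> R) (I : set R) : set R := [set y | has_deriv_ext f I y].

Definition M1_point (f : R -> R) (I : set R) (y : R) : Prop :=
  I y /\ exists2 eps, 0 < eps &
    forall x z, I x -> y - eps < x -> x < y ->
                I z -> y < z -> z < y + eps ->
                dist2 (psi f x) (psi f y) <= dist2 (psi f x) (psi f z).

Definition M1_set (f : R -> R) (I : set R) : set R := [set y | M1_point f I y].

End Defs.

(* Main.v *)
(** At an M1-point the failure of a lower (upper) bound on the right difference
quotients forces the left ones to be bounded above (below) by 0.  Hence, on one
of the two sides or for one of the two signs, all difference quotients at the
point are bounded; countably many small pieces [P] cover these points.

If [s f' >= -K] on both sides, put [h := s f + (K + 1) id]; then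
[|x - y| <= |h x - h y|] for [y] in [P] and [x] near [y], so the inverse of [h]
on [P] has largest and smallest 1-Lipschitz extensions, and these squeeze [x]
as a function of [h x].  If the quotients are bounded on one side only, [f] is
Lipschitz on [P]; extend it, and use that where the distance to [P] is
differentiable, [P] has points of the good side arbitrarily close to [x],
relative to [|x - y|].  In both cases [f] has a derivative wherever two
Lipschitz functions of one real parameter are differentiable, i.e. almost
everywhere, and the graph over [P] is a Lipschitz image of that parameter. *)

Require Import Defs.
From HB Require Import structures.
From mathcomp Require Import all_boot all_order all_algebra.
From mathcomp Require Import all_classical all_reals all_analysis.
From mathcomp Require Import ring lra.
Import Order.TTheory GRing.Theory Num.Theory.
Import numFieldNormedType.Exports.
Local Open Scope classical_set_scope.
Local Open Scope ring_scope.
Set Implicit Arguments.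
Unset Strict Implicit.
Unset Printing Implicit Defensive.

(** * Lipschitz functions are differentiable almost everywhere *)

Definition has_linear_approx (R : realType) (F : R -> R) (u c : R) : Prop :=
  forall e, 0 < e -> exists2 d, 0 < d &
    forall v, `|v - u| < d -> `|F v - F u - c * (v - u)| <= e * `|v - u|.

Lemma derivable_has_linear_approx (R : realType) (F : R -> R) (u : R) :
  derivable F u 1 -> has_linear_approx F u ('D_1 F u).
Proof.
move=> dF e e0.
have : h^-1 *: (F (h *: 1 + u) - F u) @[h --> 0%R^'] --> 'D_1 F u by exact: dF.
move=> /(@cvgrPdist_le _ R^o) /(_ _ e0).
move=> [d /= d0 H]; exists d => // v vu.
have [->|vu0] := eqVneq v u; first by rewrite !subrr mulr0 subrr normr0 mulr0.
have vu0' : v - u != 0 by rewrite subr_eq0.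
have := H (v - u); rewrite /ball/= sub0r normrN => /(_ vu vu0').
rewrite [_ *: 1]mulr1 subrK /GRing.scale/= => {}H.
rewrite -ler_pdivrMr ?normr_gt0// -normrV ?unitfE// -normrM.
rewrite distrC in H; apply: le_trans H.
by rewrite le_eqVlt; apply/orP; left; apply/eqP; congr `|_|; field.
Qed.

(** Only increments near [u] matter, so an indefinite integral of a density can stand in for the
    function itself. *)
Lemma has_linear_approx_local (R : realType) (F G : R -> R) (u c r : R) :
  0 < r -> (forall v, `|v - u| < r -> F v - F u = G v - G u) ->
  has_linear_approx F u c -> has_linear_approx G u c.
Proof.
move=> r0 FG Fc e /Fc[d d0 H]; exists (Num.min d r); first by rewrite lt_min d0.
by move=> v; rewrite lt_min => /andP[vd vr]; rewrite -FG//; exact: H.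
Qed.

Lemma has_linear_approxB (R : realType) (F G : R -> R) (u c c' : R) :
  has_linear_approx F u c -> has_linear_approx G u c' ->
  has_linear_approx (fun v => F v - G v) u (c - c').
Proof.
move=> Fc Gc e e0; have e20 : 0 < e / 2 by rewrite divr_gt0.
have [d d0 H] := Fc _ e20; have [d' d'0 H'] := Gc _ e20.
exists (Num.min d d'); first by rewrite lt_min d0.
move=> v; rewrite lt_min => /andP[/H {}H /H' {}H'].
have -> : F v - G v - (F u - G u) - (c - c') * (v - u) =
  (F v - F u - c * (v - u)) - (G v - G u - c' * (v - u)) by ring.
by apply: le_trans (ler_normB _ _) _; lra.
Qed.

(** If [c != 0], a move of length [d / 2] against the sign of [c] would lower [F] by at least |c| d
    / 4 below its minimum. *)
Lemma has_linear_approx_min (R : realType) (F : R -> R) (u c : R) :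
  (forall v, F u <= F v) -> has_linear_approx F u c -> c = 0.
Proof.
move=> Fmin Fc; apply/eqP; apply: contraT => c0.
have [|d d0 H] := Fc (`|c| / 2); first by rewrite divr_gt0 ?normr_gt0.
pose t := - Num.sg c * (d / 2).
have nt : `|t| = d / 2.
  by rewrite normrM normrN normr_sg c0 mul1r ger0_norm//; lra.
have d2 : d / 2 < d by lra.
have := H (u + t); rewrite addrAC subrr add0r nt => /(_ d2).
have -> : c * t = - (`|c| * (d / 2)) by rewrite /t normrEsg; ring.
have := Fmin (u + t); have c1 : 0 < `|c| by rewrite normr_gt0.
move=> F0; rewrite ger0_norm; nra.
Qed.

Lemma negligible_ocitv_cover (R : realType) (N : set R) (e : R) :
  lebesgue_measure.-negligible N -> 0 < e ->
  exists a b : nat -> R, [/\ forall k, a k <= b k,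
    N `<=` \bigcup_k `]a k, b k]%classic &
    (\sum_(0 <= k <oo) (b k - a k)%:E <= e%:E)%E].
Proof.
move=> /negligible_outer_measure; rewrite /mu_ext => N0 e0.
set S := (X in ereal_inf X) in N0.
have Sfin : ereal_inf S \is a fin_num by rewrite N0.
have [_ [C [mC NC] <-]] := lb_ereal_inf_adherent e0 Sfin.
rewrite N0 add0e => Ce.
have /choice[ab abC] : forall k, exists ab : R * R,
    ab.1 <= ab.2 /\ C k = `]ab.1, ab.2]%classic.
  move=> k; have /ocitvP[->|[x /ltW x12 ->]] := mC k; last by exists x.
  by exists (0, 0); split => //=; rewrite set_itvoc0.
(* Empty members of the cover are encoded as ]0, 0]. *)
exists (fun k => (ab k).1), (fun k => (ab k).2); split.
- by move=> k; have [] := abC k.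
- by move=> x /NC[k _]; have [_ ->] := abC k; exists k.
- rewrite (eq_eseriesr (g := fun k => wlength idfun (C k))) ?ltW// => k _.
  by have [ab12 ->] := abC k; rewrite wlength_itv_bnd.
Qed.

Lemma lebesgue_stieltjes_measure_itvoc (R : realType) (f : cumulative R R)
    (a b : R) : a <= b ->
  lebesgue_stieltjes_measure f `]a, b]%classic = (f b - f a)%:E.
Proof.
move=> ab; rewrite /lebesgue_stieltjes_measure /measure_extension.
by rewrite measurable_mu_extE/= ?wlength_itv_bnd//; exact: is_ocitv.
Qed.

(* The Lebesgue-Stieltjes measure of [F] is dominated by Lebesgue measure, so [F]
   is the integral of a Radon-Nikodym derivative and FTC1 applies. *)
Section lipschitz_nondecreasing.
Variables (R : realType) (F : R -> R) (L : R).
Hypotheses (ndF : {homo F : x y / x <= y})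
  (lipF : forall x y, `|F x - F y| <= L * `|x - y|).

Let L_ge0 : 0 <= L.
Proof.
have := lipF 1 0; rewrite subr0 normr1 mulr1; exact: le_trans.
Qed.

Let rcF : right_continuous F.
Proof.
move=> a; apply/(@cvgrPdist_le _ R^o) => e e0.
have L1 : 0 < L + 1 by rewrite ltr_wpDl.
exists (e / (L + 1)) => /=; first exact: divr_gt0.
move=> x xa _; apply: (le_trans (lipF _ _)).
have := ltW xa; rewrite /ball_/= ler_pdivlMr//.
by have := normr_ge0 (a - x); nra.
Qed.

Let Fc : cumulative R R := HB.pack F (isCumulative.Build R _ R F ndF rcF).

Let LS := lebesgue_stieltjes_measure Fc.

Let LSoc (a b : R) : a <= b -> LS `]a, b]%classic = (F b - F a)%:E.
Proof. exact: lebesgue_stieltjes_measure_itvoc. Qed.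

(** Over a cover by half-open intervals of total length e / (L + 1), the increments of [F] add up to
    at most [e]. The denominator is [L + 1] because [L] may vanish. *)
Let LS_null (A : set (measurableTypeR R)) :
  measurable A -> lebesgue_measure A = 0%E -> LS A = 0%E.
Proof.
move=> mA A0; apply/eqP; rewrite eq_le measure_ge0 andbT.
apply/lee_addgt0Pr => e e0; rewrite add0e.
have L1 : 0 < L + 1 by rewrite ltr_wpDl.
have nA : lebesgue_measure.-negligible A by apply/negligibleP.
have [a [b [ab Aab abe]]] := negligible_ocitv_cover nA (divr_gt0 e0 L1).
apply: (@le_trans _ _ (\sum_(0 <= k <oo) (L + 1)%:E * (b k - a k)%:E)%E);
    last first.
  rewrite nneseriesZl; last by move=> k _; rewrite lee_fin subr_ge0.
  by rewrite -lee_pdivlMl// -EFinM mulrC.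
apply: (@le_trans _ _ (\sum_(0 <= k <oo) wlength F `]a k, b k]%classic)%E).
  apply: ereal_inf_lbound => /=; exists (fun k => `]a k, b k]%classic) => //.
  by split => // k; exact: is_ocitv.
apply: lee_nneseries => [k _ _|k _].
  by rewrite wlength_itv_bnd// lee_fin subr_ge0 ndF.
rewrite wlength_itv_bnd// -EFinM lee_fin (le_trans (ler_norm _))//.
rewrite (le_trans (lipF _ _))// ger0_norm ?subr_ge0//.
by rewrite ler_wpM2r ?subr_ge0// lerDl.
Qed.

Let negligible_bounded (n : nat) : lebesgue_measure.-negligible
  [set u | [/\ - n%:R < u, u < n%:R & ~ exists c, has_linear_approx F u c]].
Proof.
pose D : set (measurableTypeR R) := `]- n%:R, n%:R]%classic.
have mD : measurable D by exact: measurable_itv.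
have LSD : (LS D < +oo)%E.
  by rewrite /D LSoc ?ltry// ge0_cp.
(* Restriction to ]-n, n] makes the measure finite, hence its density integrable over the whole
   line, as [FTC1] requires. *)
pose nu := mfrestr mD LSD.
have nuL : nu `<< (@lebesgue_measure R).
  apply/null_content_dominatesP => A mA A0; rewrite /nu /mfrestr /mrestr.
  apply: LS_null; first exact: measurableI.
  by apply: (subset_measure0 _ mA _ A0); [exact: measurableI|exact: subIsetl].
have [f [f0 ffin fint nuE]] := radon_nikodym_sigma_finite nuL.
have ffE : (EFin \o (fine \o f)) = f by apply/funext => x /=; rewrite fineK.
have fint' : lebesgue_measure.-integrable setT (EFin \o (fine \o f)).
  by rewrite ffE.
have locf : locally_integrable setT (fine \o f).
  by apply: open_integrable_locally => //; exact: openT.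
have := @FTC1 R (fine \o f) (BRight (- n%:R)) _ locf.
case.
  by move=> y; apply: integrableS fint' => //.
move=> N [mN N0 HN]; exists N; split => //; apply: subset_trans HN.
move=> u [nu1 nu2 Hu] /= /(_ nu1)[dF _]; apply: Hu.
eexists.
(* The radius is the distance from [u] to the ends of ]-n, n[; inside, the integral of the density
   from -n to [v] is [F v - F (- n%:R)]. *)
apply: (@has_linear_approx_local _ _ _ _ _ (Num.min (n%:R - u) (u + n%:R)) _ _
  (derivable_has_linear_approx dF)).
  by rewrite lt_min; apply/andP; split; lra.
have FE v : - n%:R < v -> v < n%:R ->
    \int[lebesgue_measure]_(t in `]- n%:R, v]) (fine \o f) t = F v - F (- n%:R).
  move=> v1 v2; rewrite /Rintegral.
  under eq_integral => t _ do rewrite /= fineK//.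
  rewrite -(nuE `]- n%:R, v]%classic (measurable_itv _)).
  rewrite -[X in fine X]/(LS (`]- n%:R, v]%classic `&` D)).
  rewrite setIidl; first by rewrite LSoc// ltW.
  by apply: subset_itvl; rewrite bnd_simp ltW.
move=> v; rewrite lt_min => /andP[].
rewrite !ltr_norml => /andP[h1 h2] /andP[h3 h4].
rewrite !FE//; lra.
Qed.

Lemma lipschitz_nondecreasing_ae_linear_approx : lebesgue_measure.-negligible
  [set u | ~ exists c, has_linear_approx F u c].
Proof.
have := negligible_bigcup negligible_bounded; apply: negligibleS => u Hu.
have := archi_boundP (normr_ge0 u); rewrite ltr_norml => /andP[u1 u2].
by exists (Num.bound `|u|).
Qed.

End lipschitz_nondecreasing.

(** Adding [L * x] makes [F] nondecreasing and [2 * L]-Lipschitz; the linear term is subtracted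
    again afterwards. *)
Lemma lipschitz_ae_linear_approx (R : realType) (F : R -> R) (L : R) :
  (forall x y, `|F x - F y| <= L * `|x - y|) ->
  lebesgue_measure.-negligible [set u | ~ exists c, has_linear_approx F u c].
Proof.
move=> lipF.
apply: negligibleS (@lipschitz_nondecreasing_ae_linear_approx R
  (fun x => F x + L * x) (2 * L) _ _).
- move=> u /= + [c Fc]; apply; exists (c - L).
  have FE : (fun v => F v + L * v - L * v) = F.
    by apply/funext => v; rewrite addrK.
  rewrite -FE; apply: (has_linear_approxB Fc).
  move=> e e0; exists 1 => // v _.
  by rewrite -mulrBr subrr normr0 mulr_ge0// ltW.
- move=> x y xy; have := lipF x y.
  rewrite ler_norml distrC ger0_norm ?subr_ge0// => /andP[_].
  by lra.
- move=> x y.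
  have -> : F x + L * x - (F y + L * y) = (F x - F y) + L * (x - y) by ring.
  apply: le_trans (ler_normD _ _) _; rewrite normrM.
  have L0 : 0 <= L.
    by have := lipF 1 0; rewrite subr0 normr1 mulr1; exact: le_trans.
  by rewrite (ger0_norm L0); have := lipF x y; lra.
Qed.

(** * Lipschitz extension from a subset *)

(** [Phi v] is the infimum of g p + L |v - h p| over [P]. The last two clauses are the two halves of
    the definition of an infimum: the first bounds points outside [P], the second produces points of
    [P] when [Phi] is the distance to [P]. *)
Lemma mcshane_extension (R : realType) (P : set R) (g h : R -> R) (L : R) :
  0 <= L -> P !=set0 ->
  (forall p q, P p -> P q -> `|g p - g q| <= L * `|h p - h q|) ->
  exists Phi : R -> R, [/\ forall u v, `|Phi u - Phi v| <= L * `|u - v|,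
    forall p, P p -> Phi (h p) = g p,
    forall x v, (forall p, P p -> x <= g p + L * `|v - h p|) -> x <= Phi v &
    forall v t, Phi v < t -> exists2 p, P p & g p + L * `|v - h p| < t].
Proof.
move=> L0 [p0 Pp0] lip.
pose S v := [set g p + L * `|v - h p| | p in P].
have S0 v : S v !=set0 by exists (g p0 + L * `|v - h p0|), p0.
have Slb v : has_lbound (S v).
  exists (g p0 - L * `|v - h p0|) => _ [p Pp <-].
  have := lip _ _ Pp0 Pp; rewrite ler_norml => /andP[_].
  have := ler_wpM2l L0 (ler_distD v (h p0) (h p)).
  by rewrite mulrDr (distrC (h p0) v); lra.
have Sle v p : P p -> inf (S v) <= g p + L * `|v - h p|.
  by move=> Pp; apply: ge_inf => //; exists p.
have leS v x : (forall p, P p -> x <= g p + L * `|v - h p|) -> x <= inf (S v).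
  by move=> H; apply: lb_le_inf => // _ [p Pp <-]; exact: H.
have Slip u v : inf (S u) - L * `|u - v| <= inf (S v).
  apply: leS => p Pp; have := Sle u p Pp.
  by have := ler_wpM2l L0 (ler_distD v u (h p)); rewrite mulrDr; lra.
exists (fun v => inf (S v)); split => //.
- move=> u v; rewrite ler_norml; apply/andP; split.
    by have := Slip v u; rewrite (distrC v); lra.
  by have := Slip u v; lra.
- move=> p Pp; apply/eqP; rewrite eq_le; apply/andP; split.
    by rewrite (le_trans (Sle _ _ Pp))// subrr normr0 mulr0 addr0.
  apply: leS => q Pq; have := lip _ _ Pp Pq; rewrite ler_norml => /andP[_].
  by lra.
- by move=> x v; exact: leS.
- move=> v t vt; rewrite -subr_gt0 in vt.
  have [_ [p Pp <-] ht] := inf_adherent vt (conj (S0 v) (Slb v)).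
  by exists p => //; rewrite subrKC in ht.
Qed.

(** * Sets of vanishing one-dimensional Hausdorff measure *)

Lemma ler_dist2 (R : realType) (p q : R * R) :
  dist2 p q <= `|p.1 - q.1| + `|p.2 - q.2|.
Proof.
rewrite /dist2 -[leRHS]ger0_norm ?addr_ge0// -[leRHS]sqrtr_sqr.
apply: ler_wsqrtr; rewrite [leRHS]sqrrD !real_normK ?num_real//.
by rewrite addrAC lerDl mulrn_wge0// mulr_ge0.
Qed.

Lemma diam2_ge0 (R : realType) (C : set (R * R)) : (0 <= diam2 C)%E.
Proof. by apply: ereal_sup_ubound; left. Qed.

Lemma diam2_le (R : realType) (C : set (R * R)) (d : R) : 0 <= d ->
  (forall p q, C p -> C q -> dist2 p q <= d) -> (diam2 C <= d%:E)%E.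
Proof.
move=> d0 Cd; apply: ge_ereal_sup => _ [->|[p Cp [q Cq <-]]].
  by rewrite lee_fin.
by rewrite lee_fin Cd.
Qed.

Lemma diam2_set0 (R : realType) : diam2 (set0 : set (R * R)) = 0%E.
Proof.
by apply/eqP; rewrite eq_le diam2_ge0 andbT; apply: diam2_le => // p q.
Qed.

(* The mesh condition on the covers is automatic here: a cover of total
   diameter at most [e] has mesh at most [e]. *)
Definition h1_null (R : realType) (A : set (R * R)) : Prop :=
  forall e : R, 0 < e -> exists C : nat -> set (R * R),
    A `<=` \bigcup_i C i /\ (\sum_(0 <= i <oo) diam2 (C i) <= e%:E)%E.

Lemma h1_null_hausdorff1 (R : realType) (A : set (R * R)) :
  h1_null A -> hausdorff1 A = 0%E.
Proof.
move=> A0.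
have H0 d : (0 <= hausdorff1_delta d A)%E.
  apply: le_ereal_inf_tmp => _ [C _ <-]; apply: nneseries_ge0 => k _ _.
  exact: diam2_ge0.
have H1 d : 0 < d -> hausdorff1_delta d A = 0%E.
  move=> d0; apply/eqP; rewrite eq_le H0 andbT.
  apply/lee_addgt0Pr => e e0; rewrite add0e.
  have [|C [AC Ce]] := A0 (Num.min d e); first by rewrite lt_min d0.
  apply: (@le_trans _ _ (\sum_(0 <= i <oo) diam2 (C i))%E); last first.
    by rewrite (le_trans Ce)// lee_fin ge_min lexx orbT.
  apply: ereal_inf_lbound => /=; exists C => //; split => // i.
  apply: le_trans (le_trans Ce _); last by rewrite lee_fin ge_min lexx.
  rewrite (@nneseriesD1 _ _ i)//; last by move=> *; exact: diam2_ge0.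
  by rewrite leeDl// nneseries_ge0// => *; exact: diam2_ge0.
apply/eqP; rewrite eq_le; apply/andP; split.
  by apply: ge_ereal_sup => _ [d /H1 -> <-].
by apply: ereal_sup_ubound; exists 1 => //=; exact: H1.
Qed.

Lemma h1_nullS (R : realType) (A B : set (R * R)) :
  A `<=` B -> h1_null B -> h1_null A.
Proof.
move=> AB B0 e /B0[C [BC Ce]]; exists C; split => //.
exact: subset_trans AB BC.
Qed.

Lemma h1_null0 (R : realType) : h1_null (set0 : set (R * R)).
Proof.
move=> e e0; exists (fun=> set0); split => //.
by rewrite eseries0 ?lee_fin ?ltW// => i _ _; exact: diam2_set0.
Qed.

(** The [n]-th set gets a cover of total diameter at most e / 2^(n+1). A bijection of nat with nat *
    nat enumerates all these covers, and the nonnegative double sum is regrouped by rows. *)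
Lemma h1_null_bigcup_nat (R : realType) (A : nat -> set (R * R)) :
  (forall n, h1_null (A n)) -> h1_null (\bigcup_n A n).
Proof.
move=> A0 e e0.
have en n : 0 < e / (2 ^ n.+1)%:R by rewrite divr_gt0// ltr0n expn_gt0.
have /choice[G PG] := fun n => A0 n _ (en n).
pose a := (@diam2 R) \o uncurry G.
have a0 x : (0 <= a x)%E by exact: diam2_ge0.
have /card_esym/ppcard_eqP[f] := card_nat2.
exists (uncurry G \o f); split.
  move=> t [i _ /((PG i).1 _)[j _ Gt]]; exists (f^-1%FUN (i, j)) => //=.
  by rewrite invK ?inE.
rewrite -[leLHS](_ : (\esum_(i in setT) a i = _)%E); last first.
  rewrite -(esum_pred_image a f xpredT) ?[fun=> _]set_true//; congr esum.
  apply/seteqP; split => // x _; exists (f^-1%FUN x) => //.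
  by rewrite invK ?inE.
rewrite (_ : esum _ _ = \sum_(0 <= i <oo) \sum_(0 <= j <oo) diam2 (G i j))%E;
    last first.
  pose J : nat -> set (nat * nat) := fun i => [set (i, j) | j in setT].
  rewrite (_ : setT = \bigcup_k J k); last first.
    by rewrite predeqE => -[x y]; split => // _; exists x => //; exists y.
  rewrite esum_bigcupT//=; last first.
    apply/trivIsetP => i j _ _ ij.
    rewrite predeqE => -[n m] /=; split => //= -[] [_] _ [<-{n} _].
    by move=> [m' _] [] /esym/eqP; rewrite (negbTE ij).
  rewrite -(image_id [set: nat]) -fun_true esum_pred_image//; last first.
    by move=> n _; exact: esum_ge0.
  apply: eq_eseriesr => /= j _.
  rewrite -(esum_pred_image a (pair j) predT)//=; last first.
    by move=> ? ? _ _; exact: (@can_inj _ _ _ snd).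
  by congr esum; rewrite predeqE => -[x y]; split; move=> [i _ <-]; exists i.
apply: le_trans (epsilon_trick0 xpredT (ltW e0)).
apply: lee_nneseries => [i _ _|i _]; last exact: (PG i).2.
by apply: nneseries_ge0 => *; exact: diam2_ge0.
Qed.

Lemma h1_null_bigcup (R : realType) (T : countType) (A : T -> set (R * R)) :
  (forall t, h1_null (A t)) -> h1_null (\bigcup_t A t).
Proof.
move=> A0.
pose B n := if unpickle n is Some t then A t else set0.
apply: (@h1_nullS _ _ (\bigcup_n B n)).
  by move=> p [t _ Ap]; exists (pickle t) => //; rewrite /B pickleK.
apply: h1_null_bigcup_nat => n; rewrite /B.
by case: unpickle => [t|]; [exact: A0|exact: h1_null0].
Qed.

(** Intervals covering the image of [E] under [h], of total length e / L, pull back to pieces of the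
    graph whose diameters are at most [L] times the lengths. *)
Lemma h1_null_graph_on (R : realType) (f h : R -> R) (E : set R) (L : R) :
  0 < L ->
  (forall y y', E y -> E y' ->
    dist2 (psi f y) (psi f y') <= L * `|h y - h y'|) ->
  lebesgue_measure.-negligible (h @` E) -> h1_null (graph_on f E).
Proof.
move=> L0 lip hE e e0.
have [a [b [ab Eab abe]]] := negligible_ocitv_cover hE (divr_gt0 e0 L0).
exists (fun k => psi f @` (E `&` h @^-1` `]a k, b k]%classic)); split.
  move=> _ [y Ey <-].
  have [|k _ hk] := Eab (h y); first by exists y.
  by exists k => //; exists y.
apply: (@le_trans _ _ (\sum_(0 <= k <oo) L%:E * (b k - a k)%:E)%E); last first.
  rewrite nneseriesZl; last by move=> k _; rewrite lee_fin subr_ge0.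
  by rewrite -lee_pdivlMl// -EFinM mulrC.
apply: lee_nneseries => [k _ _|k _]; first exact: diam2_ge0.
rewrite -EFinM; apply: diam2_le; first by rewrite mulr_ge0 ?(ltW L0)// subr_ge0.
move=> _ _ [y [Ey hy] <-] [y' [Ey' hy'] <-]; apply: le_trans (lip _ _ Ey Ey') _.
rewrite ler_pM2l// ler_norml.
move: hy hy'; rewrite /= !in_itv/= => /andP[? ?] /andP[? ?].
by apply/andP; split; lra.
Qed.

(** * Points with bounded difference quotients *)

(* [s * diffq f y x + (K + 1)] is the difference quotient of
   [h := s * f + (K + 1) * id], and [c] is its inverse derivative. *)
Lemma has_deriv_ext_inverse (R : realType) (f : R -> R) (I : set R)
    (s K c y : R) : I y -> s = 1 \/ s = -1 -> 0 <= K ->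
  (forall e, 0 < e -> exists2 d, 0 < d & forall x, I x -> x != y ->
    `|x - y| < d -> let q := s * diffq f y x + (K + 1) in
      1 <= q /\ `|1 - c * q| <= e * q) ->
  has_deriv_ext f I y.
Proof.
(* For [c <= 0] one has 1 <= |1 - c q| <= e q, so [q] tends to infinity and the derivative is
   infinite, with the sign of [s]. *)
move=> Iy s1 K0 H; split => //; have [c0|c0] := leP c 0.
  right.
  suff Hinf M : exists2 d, 0 < d &
      forall x, I x -> x != y -> `|x - y| < d -> M < s * diffq f y x.
    case: s1 Hinf => -> Hinf.
      by left => M; have [d d0 Hd] := Hinf M; exists d => // x Ix xy xd;
        have := Hd x Ix xy xd; rewrite mul1r.
    right => M; have [d d0 Hd] := Hinf (- M); exists d => // x Ix xy xd.
    by have := Hd x Ix xy xd; lra.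
  have M0 : 0 < `|M| + K + 2 by have := normr_ge0 M; lra.
  have [|d d0 Hd] := H (`|M| + K + 2)^-1; first by rewrite invr_gt0.
  exists d => // x Ix xy xd; have [q1 q2] := Hd x Ix xy xd.
  move: q1 q2; set q := _ + _ => q1 q2.
  have : 1 <= (`|M| + K + 2)^-1 * q.
    by apply: le_trans q2; rewrite ger0_norm; nra.
  rewrite mulrC ler_pdivlMr// mul1r => q3.
  by have := ler_norm M; rewrite /q in q3; lra.
left; exists (s * (c^-1 - (K + 1))) => e e0.
have c20 : 0 < c / 2 by lra.
have ce0 : 0 < e * c ^+ 2 / 3 by rewrite divr_gt0// mulr_gt0// exprn_gt0.
(* The bound [c / 2] gives [c * q <= 2]; with it the other bound gives |1 - c q| < e c, that is, |q
   - 1/c| < e. *)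
have [|d d0 Hd] := H (Num.min (c / 2) (e * c ^+ 2 / 3)).
  by rewrite lt_min c20.
exists d => // x Ix xy xd; have [q1 q2] := Hd x Ix xy xd.
move: q1 q2; set q := _ + _ => q1 q2.
have -> : diffq f y x - s * (c^-1 - (K + 1)) = s * (q - c^-1).
  by rewrite /q; case: s1 => ->; ring.
have -> : `|s * (q - c^-1)| = `|1 - c * q| / c.
  rewrite normrM; have -> : `|s| = 1 by case: s1 => ->; rewrite ?normrN normr1.
  rewrite mul1r -[X in _ / X](gtr0_norm c0) -normf_div distrC; congr `|_|.
  by field; rewrite gt_eqF.
rewrite ltr_pdivrMr//.
have q2a : `|1 - c * q| <= (c / 2) * q.
  by apply: le_trans q2 _; rewrite ler_wpM2r ?ge_min ?lexx//; lra.
have q2b : `|1 - c * q| <= (e * c ^+ 2 / 3) * q.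
  by apply: le_trans q2 _; rewrite ler_wpM2r ?ge_min ?lexx ?orbT//; lra.
have cq : c * q <= 2 by move: q2a; rewrite ler_norml => /andP[]; lra.
apply: le_lt_trans q2b _.
have -> : e * c ^+ 2 / 3 * q = e * c * ((c * q) / 3) by ring.
by rewrite -[ltRHS]mulr1 ltr_pM2l ?mulr_gt0//; lra.
Qed.

(** Here [dP] models the distance to [P]. Its zero derivative at [y] puts a point [p] of [P] within
    a small multiple of |x - y| of [x], on the side where the bound at [p] applies to [x]. As [f]
    and [Phi] agree at [p], the approximation of [Phi] carries over to [f]. *)
Lemma has_deriv_ext_one_sided_lipschitz (R : realType) (f Phi dP : R -> R)
    (I P : set R) (s K r c y : R) : s = 1 \/ s = -1 -> 0 <= K -> 0 < r ->
  I y -> P y ->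
  (forall p x, P p -> I x -> 0 < s * (x - p) < r ->
    `|f x - f p| <= K * `|x - p|) ->
  (forall u v, `|Phi u - Phi v| <= K * `|u - v|) ->
  (forall p, P p -> Phi p = f p) ->
  dP y = 0 ->
  (forall v t, dP v < t -> exists2 p, P p & `|v - p| < t) ->
  has_linear_approx Phi y c -> has_linear_approx dP y 0 ->
  has_deriv_ext f I y.
Proof.
move=> s1 K0 r0 Iy Py Pf lipPhi PhiP dPy dPP Phic dPc; split => //.
left; exists c => e e0.
have K1 : 0 < K + 1 by lra.
(* The first term keeps |x - p| <= |x - y| < r; the second makes the error 2 K |x - p| at most (e /
   2) |x - y|. *)
pose eta := Num.min (1 / 2) (e / (8 * (K + 1))).
have eta0 : 0 < eta by rewrite lt_min !divr_gt0// mulr_gt0.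
have eta2 : eta <= 1 / 2 by rewrite ge_min lexx.
have etaK : eta * (8 * (K + 1)) <= e.
  by rewrite -ler_pdivlMr ?mulr_gt0// ge_min lexx orbT.
have [|d1 d10 H1] := dPc (eta / 2); first by lra.
have [|d2 d20 H2] := Phic (e / 4); first by lra.
exists (Num.min (d1 / 2) (Num.min d2 r)).
  by rewrite !lt_min r0 d20 divr_gt0.
move=> x Ix xy; rewrite !lt_min => /and3P[xd1 xd2 xr].
have D0 : 0 < `|x - y| by rewrite normr_gt0 subr_eq0.
have eD : 0 < eta * `|x - y| by rewrite mulr_gt0.
have eD2 : eta * `|x - y| <= `|x - y| / 2.
  by rewrite mulrC ler_pM2l//; lra.
(* The target is moved off [x] against [s], so that every [p] closer than eta |x - y| to [v]
   satisfies 0 < s (x - p). *)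
pose v := x - s * (eta * `|x - y|).
have ns : `|s| = 1 by case: s1 => ->; rewrite ?normrN normr1.
have vy : `|v - y| <= 3 / 2 * `|x - y|.
  have -> : v - y = (x - y) - s * (eta * `|x - y|) by rewrite /v; ring.
  apply: le_trans (ler_normB _ _) _.
  by rewrite normrM ns mul1r (gtr0_norm eD); lra.
have [|p Pp vp] := dPP v (eta * `|x - y|).
  have vd1 : `|v - y| < d1 by lra.
  have := H1 _ vd1; rewrite dPy mul0r !subr0 => H.
  apply: le_lt_trans (ler_norm _) _; apply: le_lt_trans H _.
  have : eta / 2 * `|v - y| <= eta / 2 * (3 / 2 * `|x - y|).
    by rewrite ler_pM2l//; lra.
  by move: eD; lra.
have xp : `|x - p| <= 2 * (eta * `|x - y|).
  have -> : x - p = s * (eta * `|x - y|) + (v - p) by rewrite /v; ring.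
  apply: le_trans (ler_normD _ _) _.
  by rewrite normrM ns mul1r (gtr0_norm eD); lra.
have sxp0 : 0 < s * (x - p).
  have -> : s * (x - p) = eta * `|x - y| + s * (v - p).
    by rewrite /v; case: s1 => ->; ring.
  have : `|s * (v - p)| < eta * `|x - y| by rewrite normrM ns mul1r.
  by rewrite ltr_norml => /andP[]; lra.
have sxp : 0 < s * (x - p) < r.
  rewrite sxp0/=; apply: le_lt_trans (ler_norm _) _.
  by rewrite normrM ns mul1r; lra.
have A1 := Pf _ _ Pp Ix sxp.
have A2 := lipPhi p x; rewrite distrC in A2.
have A3 := H2 _ xd2.
have A4 : `|f x - f y - c * (x - y)| <= 2 * (K * `|x - p|) + e / 4 * `|x - y|.
  have -> : f x - f y - c * (x - y) = (f x - f p) + - (Phi x - Phi p) +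
    (Phi x - Phi y - c * (x - y)) by rewrite (PhiP p)// (PhiP y)//; ring.
  apply: le_trans (ler_normD _ _) _; apply: lerD A3.
  apply: le_trans (ler_normD _ _) _; rewrite normrN.
  by rewrite (distrC p) in A2; lra.
have A5 : 2 * (K * `|x - p|) <= e / 2 * `|x - y|.
  have : K * `|x - p| <= K * (2 * (eta * `|x - y|)) by rewrite ler_wpM2l.
  have : eta * (8 * (K + 1)) * `|x - y| <= e * `|x - y| by rewrite ler_pM2r.
  by move: eD; nra.
have -> : diffq f y x - c = (f x - f y - c * (x - y)) / (x - y).
  by rewrite /diffq; field; rewrite subr_eq0.
rewrite normf_div ltr_pdivrMr//.
have : 0 < e * `|x - y| by rewrite mulr_gt0.
by lra.
Qed.

Section cone.
Variables (R : realType) (f : R -> R) (I P : set R) (s K r : R).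
Hypotheses (s1 : s = 1 \/ s = -1) (K0 : 0 <= K) (r0 : 0 < r).
Hypothesis cont : forall y, I y -> forall e, 0 < e -> exists2 d, 0 < d &
  forall x, I x -> `|x - y| < d -> `|f x - f y| < e.
Hypothesis PI : P `<=` I.
Hypothesis Pcone : forall y x, P y -> I x -> `|x - y| < 2 * r ->
  - K * (x - y) ^+ 2 <= s * (f x - f y) * (x - y).
Hypothesis Psmall : forall y y', P y -> P y' -> `|y - y'| < r.

Let h x := s * f x + (K + 1) * x.

Let hcone y x : P y -> I x -> `|x - y| < 2 * r ->
  (x - y) ^+ 2 <= (h x - h y) * (x - y).
Proof. by move=> Py Ix xy; have := Pcone Py Ix xy; rewrite /h; lra. Qed.

Let hexp y x : P y -> I x -> `|x - y| < 2 * r -> `|x - y| <= `|h x - h y|.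
Proof.
move=> Py Ix xy; have [->|xy0] := eqVneq x y; first by rewrite !subrr.
have D0 : 0 < `|x - y| by rewrite normr_gt0 subr_eq0.
rewrite -(ler_pM2r D0) -!normrM -expr2 ger0_norm ?sqr_ge0//.
exact: le_trans (hcone Py Ix xy) (ler_norm _).
Qed.

Let small y y' : P y -> P y' -> `|y - y'| < 2 * r.
Proof. by move=> Py Py'; move: r0 (Psmall Py Py'); lra. Qed.

Lemma h1_null_cone :
  h1_null (graph_on f (P `&` [set y | ~ has_deriv_ext f I y])).
Proof.
move: (K0) (r0) => K_ge0 r_gt0.
have [P0|/set0P P0] := eqVneq P set0.
  by rewrite P0 set0I /graph_on image_set0; exact: h1_null0.
have lip2 p q : P p -> P q -> `|p - q| <= 1 * `|h p - h q|.
  by move=> Pp Pq; rewrite mul1r hexp//; [exact: PI|exact: small].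
have lip1 p q : P p -> P q -> `|- p - - q| <= 1 * `|h p - h q|.
  by move=> Pp Pq; rewrite -opprD normrN lip2.
have [Phi2 [Phi2lip Phi2E Phi2le _]] := mcshane_extension ler01 P0 lip2.
have [Phi1 [Phi1lip Phi1E Phi1le _]] := mcshane_extension ler01 P0 lip1.
(* The smallest 1-Lipschitz extension is minus the largest extension of the negated data. *)
pose Psi v := - Phi1 v.
have Psilip u v : `|Psi u - Psi v| <= 1 * `|u - v|.
  by rewrite /Psi -opprD normrN.
have PsiPhi2 v : Psi v <= Phi2 v.
  rewrite lerNl; apply: Phi1le => p Pp; rewrite lerNl opprD opprK.
  apply: Phi2le => q Pq; have := lip2 _ _ Pp Pq.
  have := ler_norm (p - q).
  by have := ler_distD v (h p) (h q); rewrite (distrC (h p) v); lra.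
(* Relative to |h y - h y'|, the first coordinate contributes 1 and the second 1 + (K + 1). *)
apply: (@h1_null_graph_on _ f h _ (K + 3)); first by lra.
  move=> y y' [Py _] [Py' _]; apply: le_trans (ler_dist2 _ _) _ => /=.
  have H1 : `|y - y'| <= `|h y - h y'| by rewrite -[leRHS]mul1r lip2.
  have -> : f y - f y' = s * ((h y - h y') - (K + 1) * (y - y')).
    by rewrite /h; case: s1 => ->; ring.
  rewrite normrM; have -> : `|s| = 1 by case: s1 => ->; rewrite ?normrN normr1.
  have H2 := ler_normB (h y - h y') ((K + 1) * (y - y')).
  have H3 : `|(K + 1) * (y - y')| <= (K + 1) * `|h y - h y'|.
    by rewrite normrM ger0_norm ?ler_wpM2l//; lra.
  by lra.
apply: negligibleS (negligibleU (lipschitz_ae_linear_approx Psilip)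
  (lipschitz_ae_linear_approx Phi2lip)).
move=> _ [y [Py Ny] <-] /=.
apply: contrapT => /not_orP[/contrapT[c1 Hc1] /contrapT[c2 Hc2]]; apply: Ny.
have Phi2y := Phi2E y Py.
have Psiy : Psi (h y) = y by rewrite /Psi Phi1E// opprK.
(* [Phi2 - Psi] is nonnegative and vanishes at [h y], so its derivative there is 0. *)
have c12 : c1 = c2.
  apply/eqP; rewrite eq_sym -subr_eq0; apply/eqP.
  apply: has_linear_approx_min (has_linear_approxB Hc2 Hc1) => v /=.
  by rewrite Phi2y Psiy subrr subr_ge0.
rewrite -{c2}c12 in Hc2.
apply: (@has_deriv_ext_inverse _ f I s K c1 y) => //; first exact: PI.
move=> e e0.
have [d1 d10 H1] := Hc1 _ e0; have [d2 d20 H2] := Hc2 _ e0.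
have [|d3 d30 H3] := cont (PI Py) (e := Num.min d1 d2 / 2).
  by rewrite divr_gt0// lt_min d10.
have d40 : 0 < Num.min d1 d2 / (2 * (K + 1)).
  by rewrite divr_gt0 ?lt_min ?d10//; lra.
exists (Num.min d3 (Num.min r (Num.min d1 d2 / (2 * (K + 1))))).
  by rewrite !lt_min d30 r0.
move=> x Ix xy; rewrite !lt_min => /and3P[xd3 xr xd4].
have D0 : 0 < `|x - y| by rewrite normr_gt0 subr_eq0.
have xy0 : x - y != 0 by rewrite subr_eq0.
have hd : `|h x - h y| < Num.min d1 d2.
  have -> : h x - h y = s * (f x - f y) + (K + 1) * (x - y) by rewrite /h; ring.
  apply: le_lt_trans (ler_normD _ _) _; rewrite !normrM.
  have -> : `|s| = 1 by case: s1 => ->; rewrite ?normrN normr1.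
  rewrite (ger0_norm (_ : 0 <= K + 1)); last by lra.
  have := H3 _ Ix xd3; move: xd4; rewrite ltr_pdivlMr; last by lra.
  by lra.
(* Although [x] need not lie in [P], it is within [2 * r] of every point of [P], so [hexp] applies
   and [x] lies between [Psi (h x)] and [Phi2 (h x)]. *)
have xle2 : x <= Phi2 (h x).
  apply: Phi2le => p Pp; have : `|x - p| <= `|h x - h p|.
    apply: hexp => //; have := Psmall Py Pp; have := ler_distD y x p; lra.
  by have := ler_norm (x - p); lra.
have xle1 : Psi (h x) <= x.
  rewrite lerNl; apply: Phi1le => p Pp; have : `|x - p| <= `|h x - h p|.
    apply: hexp => //; have := Psmall Py Pp; have := ler_distD y x p; lra.
  by have := ler_norm (p - x); rewrite distrC; lra.
have xy2 : `|x - y| < 2 * r by lra.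
have Hq : s * diffq f y x + (K + 1) = (h x - h y) / (x - y).
  by rewrite /diffq /h; field.
have DD : 0 < (x - y) ^+ 2 by rewrite exprn_even_gt0.
move=> q; have q1 : 1 <= q.
  rewrite /q Hq -(ler_pM2r DD) mul1r.
  have -> : (h x - h y) / (x - y) * (x - y) ^+ 2 =
      (h x - h y) * (x - y) by field.
  exact: hcone.
split => //.
have hq : h x - h y = q * (x - y) by rewrite /q Hq; field.
rewrite -(ler_pM2r D0) -normrM.
have -> : e * q * `|x - y| = e * `|h x - h y|.
  by rewrite hq normrM (ger0_norm (_ : 0 <= q)) ?mulrA//; lra.
have -> : (1 - c1 * q) * (x - y) = (x - y) - c1 * (h x - h y).
  by rewrite hq; ring.
move: hd; rewrite lt_min => /andP[/H1 + /H2]; rewrite Phi2y Psiy.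
rewrite !ler_norml => /andP[? ?] /andP[? ?].
by apply/andP; split; lra.
Qed.

End cone.

Lemma h1_null_one_sided_lipschitz (R : realType) (f : R -> R) (I P : set R)
    (s K r : R) : s = 1 \/ s = -1 -> 0 <= K -> 0 < r -> P `<=` I ->
  (forall p x, P p -> I x -> 0 < s * (x - p) < r ->
    `|f x - f p| <= K * `|x - p|) ->
  (forall p q, P p -> P q -> `|p - q| < r) ->
  h1_null (graph_on f (P `&` [set y | ~ has_deriv_ext f I y])).
Proof.
move=> s1 K0 r0 PI Pf Psmall.
have [P0|/set0P P0] := eqVneq P set0.
  by rewrite P0 set0I /graph_on image_set0; exact: h1_null0.
have ns : `|s| = 1 by case: s1 => ->; rewrite ?normrN normr1.
(* Of two points of [P], one lies on the good side of the other, so the one-sided bound is a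
   Lipschitz bound on [P]. *)
have lip p q : P p -> P q -> `|f p - f q| <= K * `|p - q|.
  move=> Pp Pq; have [->|pq] := eqVneq p q.
    by rewrite !subrr normr0 mulr0.
  have spq : s * (q - p) != 0.
    by rewrite mulf_neq0 -?normr_gt0 ?ns// normr_gt0 subr_eq0 eq_sym.
  have [spq0|spq0] := ltP 0 (s * (p - q)).
    apply: Pf => //; first exact: PI.
    rewrite spq0/=; apply: le_lt_trans (ler_norm _) _.
    by rewrite normrM ns mul1r; exact: Psmall.
  rewrite distrC (distrC p); apply: Pf => //; first exact: PI.
  apply/andP; split.
    by rewrite lt_def spq/= -opprB mulrN oppr_ge0.
  apply: le_lt_trans (ler_norm _) _.
  by rewrite normrM ns mul1r; exact: Psmall.
have [Phi [Philip PhiE _ _]] := @mcshane_extension _ _ f id _ K0 P0 lip.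
(* The extension of the zero function with constant 1 is the distance to [P]; it is minimal on [P],
   so its derivative there can only be 0. *)
have lip0 p q : P p -> P q -> `|(0 : R) - 0| <= 1 * `|p - q|.
  by move=> _ _; rewrite subrr normr0 mul1r.
have [dP [dPlip dPE dPge dPlt]] :=
  @mcshane_extension _ _ (fun=> 0) id _ ler01 P0 lip0.
apply: (@h1_null_graph_on _ f id _ (K + 1)); first by lra.
  move=> y y' [Py _] [Py' _]; apply: le_trans (ler_dist2 _ _) _ => /=.
  by have := lip _ _ Py Py'; lra.
apply: negligibleS (negligibleU (lipschitz_ae_linear_approx Philip)
  (lipschitz_ae_linear_approx dPlip)).
move=> _ [y [Py Ny] <-] /=.
apply: contrapT => /not_orP[/contrapT[c1 Hc1] /contrapT[c2 Hc2]]; apply: Ny.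
have dPy := dPE y Py.
have c20 : c2 = 0.
  apply: has_linear_approx_min Hc2 => v; rewrite dPy.
  by apply: dPge => p Pp; rewrite add0r mul1r.
rewrite c20 in Hc2.
apply: (@has_deriv_ext_one_sided_lipschitz _ f Phi dP I P s K r c1 y) => //.
  exact: PI.
by move=> v t /dPlt[p Pp]; rewrite add0r mul1r; exists p.
Qed.

(** * M1-points *)

Lemma within_continuous_eps (R : realType) (I : set R) (f : R -> R) :
  {within I, continuous f} -> forall y, I y -> forall e, 0 < e ->
  exists2 d, 0 < d & forall x, I x -> `|x - y| < d -> `|f x - f y| < e.
Proof.
move=> cf y Iy e e0.
have /subspace_continuousP /(_ y Iy) /(@cvgrPdist_lt _ R^o) /(_ _ e0) := cf.
move=> [d /= d0 H].
exists d => // x Ix xy; rewrite distrC; apply: H => //.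
by rewrite /ball_ /= distrC.
Qed.

(** With [p], [q] the difference quotients to the left and right points, the difference of squared
    distances is |psi z - psi y|^2 + 2 (y - x) (z - y) (1 + p q). Near a point of [D_set], [p] and
    [q] have the same sign, or both are below 1 in absolute value when the derivative is 0. *)
Lemma D_set_sub_M1_set (R : realType) (I : set R) (f : R -> R) :
  D_set f I `<=` M1_set f I.
Proof.
move=> y [Iy Hy]; split => //.
suff [d d0 H] : exists2 d, 0 < d & forall x z, I x -> x != y -> `|x - y| < d ->
    I z -> z != y -> `|z - y| < d -> 0 <= 1 + diffq f y x * diffq f y z.
  exists d => // x z Ix yx xy Iz yz zy.
  have xny : x != y by rewrite lt_eqF.
  have zny : z != y by rewrite gt_eqF.
  have /H : `|x - y| < d by rewrite ltr_norml; apply/andP; split; lra.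
  move=> /(_ z Ix xny Iz zny); rewrite ltr_norml => H1.
  have {H1} : 0 <= 1 + diffq f y x * diffq f y z.
    by apply: H1; apply/andP; split; lra.
  have fxE : f x - f y = diffq f y x * (x - y).
    by rewrite /diffq divfK// subr_eq0.
  have fzE : f z - f y = diffq f y z * (z - y).
    by rewrite /diffq divfK// subr_eq0.
  move: fxE fzE; set p := diffq f y x; set q := diffq f y z => fxE fzE pq.
  rewrite /dist2 /=; apply: ler_wsqrtr.
  rewrite -subr_ge0.
  have -> : (x - z) ^+ 2 + (f x - f z) ^+ 2 - ((x - y) ^+ 2 + (f x - f y) ^+ 2)
    = (z - y) ^+ 2 + (f z - f y) ^+ 2 +
      2 * ((y - x) * (z - y) + - (f x - f y) * (f z - f y)) by ring.
  have -> : (y - x) * (z - y) + - (f x - f y) * (f z - f y) =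
    ((y - x) * (z - y)) * (1 + p * q) by rewrite fxE fzE; ring.
  by rewrite !addr_ge0 ?sqr_ge0// !mulr_ge0//; lra.
case: Hy => [[l Hl]|[Hp|Hm]].
- have [l0|l0] := eqVneq l 0.
    have [d d0 H] := Hl 1 ltr01; exists d => // x z Ix xy xd Iz zy zd.
    have := H _ Ix xy xd; have := H _ Iz zy zd; rewrite l0 !subr0.
    set p := diffq f y x; set q := diffq f y z => q1 p1.
    have : `|p * q| <= 1 by rewrite normrM mulr_ile1// ltW.
    by rewrite ler_norml => /andP[]; lra.
  have nl0 : 0 < `|l| by rewrite normr_gt0.
  have [d d0 H] := Hl _ nl0; exists d => // x z Ix xy xd Iz zy zd.
  have := H _ Ix xy xd; have := H _ Iz zy zd.
  set p := diffq f y x; set q := diffq f y z; rewrite !ltr_norml.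
  have [lp|lm] := ger0P l.
    by move=> /andP[? _] /andP[? _]; rewrite addr_ge0// mulr_ge0//; lra.
  move=> /andP[_ ?] /andP[_ ?]; rewrite addr_ge0// mulr_le0//; lra.
- have [d d0 H] := Hp 0; exists d => // x z Ix xy xd Iz zy zd.
  by rewrite addr_ge0// mulr_ge0// ltW// H.
- have [d d0 H] := Hm 0; exists d => // x z Ix xy xd Iz zy zd.
  by rewrite addr_ge0// mulr_le0// ltW// H.
Qed.

(* [t] selects the side of [y] and [s] the sign of the bound. *)
Definition bounded_derivate (R : realType) (f : R -> R) (I : set R)
    (t s y : R) : Prop :=
  exists K r, [/\ 0 <= K, 0 < r & forall x, I x -> 0 < t * (x - y) < r ->
    - K * (x - y) ^+ 2 <= s * (f x - f y) * (x - y)].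

(** If a left point [x] had [s * (f x - f y) < 0], a right point [z] near [y] where the graph is
    steep in that same vertical direction would have [psi f z] closer to [psi f x] than [psi f y]
    is. *)
Lemma M1_point_unbounded_right (R : realType) (f : R -> R) (I : set R)
    (s y : R) : s = 1 \/ s = -1 -> {within I, continuous f} ->
  M1_point f I y -> ~ bounded_derivate f I 1 s y ->
  bounded_derivate f I (-1) (- s) y.
Proof.
move=> s1 cf [Iy [eps eps0 M]] nb.
exists 0, eps; split => // x Ix /andP[x1 x2].
rewrite oppr0 mul0r !mulNr -mulrN.
suff : 0 <= s * (f x - f y) by move=> /mulr_ge0; apply; lra.
rewrite leNgt; apply/negP => a0; set a := s * (f x - f y) in a0.
have [|d d0 Hd] := within_continuous_eps cf Iy (e := - a / 2); first by lra.
have a0' : 0 < - a by lra.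
(* With [w] the vertical displacement to [z], this [K] gives z - y <= w and 4 (y - x) (z - y) <= - a
   w. Together with w < - a / 2 the cross term - 2 (- a) w outweighs all others. *)
pose K := 4 * (y - x) / - a + 1.
have K1 : 1 <= K by rewrite lerDr mulr_ge0// ?invr_ge0; lra.
apply: nb; exists K, (Num.min eps d); split; [lra|by rewrite lt_min eps0|].
move=> z Iz; rewrite mul1r lt_min => /and3P[z0 zeps zd].
rewrite leNgt; apply/negP => zK.
have Z0 : 0 < z - y by [].
have {}zK : K * (z - y) < - s * (f z - f y).
  by rewrite -(ltr_pM2r Z0); move: zK; lra.
have wd : - s * (f z - f y) < - a / 2.
  have /(Hd _ Iz) : `|z - y| < d by rewrite gtr0_norm.
  apply: le_lt_trans; apply: le_trans (ler_norm _) _.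
  by rewrite normrM normrN; case: s1 => ->; rewrite ?normrN normr1 mul1r.
have := M x z Ix; rewrite /dist2/=.
have h1 : y - eps < x by lra.
have h2 : x < y by lra.
have h3 : y < z by lra.
have h4 : z < y + eps by lra.
move=> /(_ h1 h2 Iz h3 h4); rewrite ler_sqrt ?addr_ge0 ?sqr_ge0//.
set w := - s * (f z - f y) in zK wd *.
have ABE : (f x - f y) * (f z - f y) = - a * w.
  by rewrite /a /w; case: s1 => ->; ring.
have BE : (f z - f y) ^+ 2 = w ^+ 2 by rewrite /w; case: s1 => ->; ring.
have -> : (x - z) ^+ 2 + (f x - f z) ^+ 2 = (x - y) ^+ 2 + (f x - f y) ^+ 2 +
  ((z - y) ^+ 2 + (f z - f y) ^+ 2 + 2 * (y - x) * (z - y) -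
   2 * ((f x - f y) * (f z - f y))) by ring.
rewrite ABE BE lerDl.
have XZ : 4 * (y - x) * (z - y) <= - a * w.
  have -> : 4 * (y - x) * (z - y) = - a * ((K - 1) * (z - y)).
    by rewrite /K addrK; field; lra.
  by rewrite ler_pM2l//; lra.
have zw : z - y <= w by apply: le_trans (ltW zK); rewrite ler_peMl// ltW.
have Zw : (z - y) ^+ 2 <= w ^+ 2 by rewrite ler_sqr ?nnegrE; lra.
have w0 : 0 < w by lra.
have ww : w ^+ 2 <= (- a / 2) * w by rewrite expr2 ler_pM2r// ltW.
have aw : 0 < - a * w by rewrite mulr_gt0.
by lra.
Qed.

(** Failure of a bound on the right yields the opposite bound on the left, and conversely by
    contraposition; the cases follow. The sign [(-1) ^+ s] is that of the bound in the first
    alternative and selects the side in the second. *)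
Lemma M1_point_bounded_derivate (R : realType) (f : R -> R) (I : set R)
    (y : R) : {within I, continuous f} -> M1_point f I y ->
  exists s : bool,
    (bounded_derivate f I 1 ((-1) ^+ s) y /\
     bounded_derivate f I (-1) ((-1) ^+ s) y) \/
    (bounded_derivate f I ((-1) ^+ s) 1 y /\
     bounded_derivate f I ((-1) ^+ s) (-1) y).
Proof.
move=> cf My.
have Hp := M1_point_unbounded_right (or_introl erefl) cf My.
have Hm := M1_point_unbounded_right (or_intror erefl) cf My.
rewrite opprK in Hm.
have [h11|/Hp hmm] := pselect (bounded_derivate f I 1 1 y).
  have [hm1|nhm1] := pselect (bounded_derivate f I (-1) 1 y).
    by exists false; left.
  have h1m : bounded_derivate f I 1 (-1) y by apply: contrapT => /Hm.
  by exists false; right.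
have [h1m|/Hm hm1] := pselect (bounded_derivate f I 1 (-1) y).
  by exists true; left.
by exists true; right.
Qed.

Lemma floor_eq_dist_lt (R : realType) (n : nat) (y y' : R) :
  Num.floor (y * n.+1%:R) = Num.floor (y' * n.+1%:R) ->
  `|y - y'| < n.+1%:R^-1.
Proof.
move=> yy'; have n0 : (0 : R) < n.+1%:R by rewrite ltr0n.
rewrite -[ltRHS]mul1r ltr_pdivlMr// -[X in _ * X](gtr0_norm n0) -normrM mulrBl.
have := floor_itv (y * n.+1%:R); rewrite yy' => /andP[h1 h2].
have /andP[h3 h4] := floor_itv (y' * n.+1%:R).
by rewrite ltr_norml; rewrite intrD in h2 h4; apply/andP; split; lra.
Qed.

(** * Countable cover of the M1-points *)

Section pieces.
Variables (R : realType) (f : R -> R) (I : set R).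

(** Natural [K] and [n] make the constants uniform on a piece, and the floor cell [j] keeps its
    points closer than half the radius of the bound. *)
Let cone_piece (s : bool) (K n : nat) (j : int) : set R :=
  [set y | [/\ I y,
    forall x, I x -> `|x - y| < 2 * n.+1%:R^-1 ->
      - K%:R * (x - y) ^+ 2 <= (-1) ^+ s * (f x - f y) * (x - y) &
    Num.floor (y * n.+1%:R) = j]].

Let lipschitz_piece (s : bool) (K n : nat) (j : int) : set R :=
  [set y | [/\ I y,
    forall x, I x -> 0 < (-1) ^+ s * (x - y) < n.+1%:R^-1 ->
      `|f x - f y| <= K%:R * `|x - y| &
    Num.floor (y * n.+1%:R) = j]].

Let sign1 (s : bool) : ((-1) ^+ s = 1 :> R) \/ ((-1) ^+ s = -1 :> R).
Proof. by case: s; [right|left]. Qed.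

Let cone_pieceP (s : bool) (y : R) : I y ->
  bounded_derivate f I 1 ((-1) ^+ s) y ->
  bounded_derivate f I (-1) ((-1) ^+ s) y ->
  exists K n j, cone_piece s K n j y.
Proof.
move=> Iy [K1 [r1 [K10 r10 H1]]] [K2 [r2 [K20 r20 H2]]].
have [n] : exists n : nat, 2 * n.+1%:R^-1 < Num.min r1 r2.
  have r0 : 0 < Num.min r1 r2 / 2 by rewrite divr_gt0// lt_min r10.
  have [n _ Hn] := near_infty_natSinv_lt (PosNum r0).
  by exists n; move: (Hn n (leqnn n)); rewrite /= ltr_pdivlMr// mulrC.
rewrite lt_min => /andP[nr1 nr2].
pose K := Num.bound (K1 + K2).
have HK : K1 + K2 < K%:R by apply: archi_boundP; lra.
exists K, n, (Num.floor (y * n.+1%:R)); split => // x Ix xy.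
have D0 : 0 <= (x - y) ^+ 2 by exact: sqr_ge0.
have [->|xy0] := eqVneq x y; first by rewrite !subrr expr0n/= !mulr0.
have [yx|yx] := ltP y x.
  apply: le_trans (H1 x Ix _); first by rewrite ler_wpM2r//; lra.
  by move: xy; rewrite mul1r gtr0_norm ?subr_gt0// yx => /lt_trans ->.
have {}yx : x < y by rewrite lt_neqAle xy0.
apply: le_trans (H2 x Ix _); first by rewrite ler_wpM2r//; lra.
move: xy; rewrite mulN1r ltr0_norm ?subr_lt0//.
by rewrite oppr_gt0 subr_lt0 yx => /lt_trans ->.
Qed.

Let lipschitz_pieceP (s : bool) (y : R) : I y ->
  bounded_derivate f I ((-1) ^+ s) 1 y ->
  bounded_derivate f I ((-1) ^+ s) (-1) y ->
  exists K n j, lipschitz_piece s K n j y.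
Proof.
move=> Iy [K1 [r1 [K10 r10 H1]]] [K2 [r2 [K20 r20 H2]]].
have [n] : exists n : nat, n.+1%:R^-1 < Num.min r1 r2.
  have r0 : 0 < Num.min r1 r2 by rewrite lt_min r10.
  have [n _ Hn] := near_infty_natSinv_lt (PosNum r0).
  by exists n; exact: (Hn n (leqnn n)).
rewrite lt_min => /andP[nr1 nr2].
pose K := Num.bound (K1 + K2).
have HK : K1 + K2 < K%:R by apply: archi_boundP; lra.
exists K, n, (Num.floor (y * n.+1%:R)); split => // x Ix /andP[sx sxn].
have D0 : 0 < `|x - y|.
  rewrite normr_gt0; apply: contraTneq sx => ->; rewrite mulr0 ltxx//.
have B1 : - K1 * (x - y) ^+ 2 <= 1 * (f x - f y) * (x - y).
  by apply: H1 => //; rewrite sx (lt_trans sxn).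
have B2 : - K2 * (x - y) ^+ 2 <= (-1) * (f x - f y) * (x - y).
  by apply: H2 => //; rewrite sx (lt_trans sxn).
have DD : 0 <= (x - y) ^+ 2 by exact: sqr_ge0.
have K1D : 0 <= K1 * (x - y) ^+ 2 by rewrite mulr_ge0.
have K2D : 0 <= K2 * (x - y) ^+ 2 by rewrite mulr_ge0.
have KD : (K1 + K2) * (x - y) ^+ 2 <= K%:R * (x - y) ^+ 2.
  by rewrite ler_wpM2r// ltW.
rewrite -(ler_pM2r D0) -normrM -mulrA -normrM -expr2 (ger0_norm DD) ler_norml.
by apply/andP; split; lra.
Qed.

Lemma h1_null_M1_points_not_D : {within I, continuous f} ->
  h1_null (graph_on f (M1_set f I `\` D_set f I)).
Proof.
move=> cf; have cont := within_continuous_eps cf.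
pose T := (bool * bool * nat * nat * int)%type.
(* [k] tells bounds of one sign on both sides from two-sided bounds on one side. *)
pose P (t : T) := let: (k, s, K, n, j) := t in
  (if k then cone_piece s K n j else lipschitz_piece s K n j).
apply: (@h1_nullS _ _ (\bigcup_t
    graph_on f (P t `&` [set y | ~ has_deriv_ext f I y]))).
  move=> _ [y [My nDy] <-].
  have Iy : I y by case: My.
  have [s [[b1 b2]|[b1 b2]]] := M1_point_bounded_derivate cf My.
    have [K [n [j Py]]] := cone_pieceP Iy b1 b2.
    by exists (true, s, K, n, j) => //; exists y.
  have [K [n [j Py]]] := lipschitz_pieceP Iy b1 b2.
  by exists (false, s, K, n, j) => //; exists y.
apply: h1_null_bigcup => -[[[[k s] K] n] j] /=.
have n0 : (0 : R) < n.+1%:R^-1 by rewrite invr_gt0.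
case: k.
  apply: (@h1_null_cone _ f I _ ((-1) ^+ s) K%:R n.+1%:R^-1) => //.
  - by move=> y [].
  - by move=> y x [_ Hy _]; exact: Hy.
  - by move=> y y' [_ _ yj] [_ _ y'j]; apply: floor_eq_dist_lt; rewrite yj y'j.
apply: (@h1_null_one_sided_lipschitz _ f I _ ((-1) ^+ s) K%:R n.+1%:R^-1) => //.
- by move=> y [].
- by move=> y x [_ Hy _]; exact: Hy.
- by move=> y y' [_ _ yj] [_ _ y'j]; apply: floor_eq_dist_lt; rewrite yj y'j.
Qed.

End pieces.

Theorem theorem6p3 (R : realType) (I : set R) (f : R -> R) :
  is_interval I ->
  (exists a b, I a /\ I b /\ a < b) ->
  {within I, continuous f} ->
  exists E : set R,
    [/\ E `<=` I,
        hausdorff1 (graph_on f E) = 0%E,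
        D_set f I `<=` M1_set f I
      & M1_set f I `<=` D_set f I `|` E].
Proof.
move=> _ _ cf; exists (M1_set f I `\` D_set f I); split.
- by move=> y [[]].
- exact/h1_null_hausdorff1/h1_null_M1_points_not_D.
- exact: D_set_sub_M1_set.
- by move=> y My; have [Dy|nDy] := pselect (D_set f I y); [left|right].
Qed.
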